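(* Let $\mathcal{M}$ be a Markov chain on state space $\Omega$. Let $\mathrm{d}$ be an integer valued metric on $\Omega$, and let $(X_t,Y_t)$ be a path coupling for $\mathcal{M}$ with respect to a set of pairs $S\subseteq\Omega\times\Omega$. For $(X_t,Y_t)\in S$ let $T_t$ be the smallest $t'>t$ such that $\mathrm{d}(X_{t'},Y_{t'})\neq \mathrm{d}(X_t,Y_t)$. Suppose that for some positive integer $k$, some $p>0$ and some constant $\alpha>0$, for all $(X_0,Y_0)\in S$: (i) $\Pr[T_0\le k]\ge p$, and (ii) $\mathbb{E}[\mathrm{d}(X_{T_0},Y_{T_0})/\mathrm{d}(X_0,Y_0)]\le \alpha<1$. Then the mixing time $\tau(\varepsilon)$ of $\mathcal{M}$ satisfies $$\tau(\varepsilon)\le \frac{k}{p(1-\alpha)}\ln\Big(\frac{eD}{\varepsilon(1-\alpha)}\Big),$$ where $D=\max\{\mathrm{d}(X,Y): X,Y\in\Omega\}$.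
   Context: $\mathcal{M}$ is a discrete-time, time-homogeneous Markov chain on a discrete state space $\Omega$. The mixing time $\tau(\varepsilon)$ (for $0<\varepsilon<1$) is the least $t$ such that, from every starting state, the law of the chain at every time $t'\ge t$ is within total variation distance $\varepsilon$ of the equilibrium distribution. Path coupling setting: $S\subseteq\Omega\times\Omega$ is a set of pairs of distinct states such that any two states $X,Y\in\Omega$ are joined by a path $X=Z^0,Z^1,\dots,Z^r=Y$ with $(Z^i,Z^{i+1})\in S$ for all $i$, and $\mathrm{d}(X,Y)$ is the minimum over such paths of $\sum_i \mathrm{d}(Z^i,Z^{i+1})$. A path coupling $(X_t,Y_t)$ is a Markovian coupling of two copies of $\mathcal{M}$ whose one-step transitions are specified for pairs in $S$ and extended to all pairs by composing the couplings of consecutive pairs along a path of pairs in $S$; states that are equal stay equal. For the stopping times $T_t$ above it is assumed that if $(X_t,Y_t)\in S$ and $t<t'<T_t$, then $(X_{t'},Y_{t'})\in S$ (pairs stay in $S$ until their distance changes). *)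

(* Defs.v *)
From mathcomp Require Import all_boot all_order all_algebra.
From mathcomp Require Import all_classical all_reals all_analysis.

Set Implicit Arguments.
Unset Strict Implicit.
Unset Printing Implicit Defensive.

Import Order.TTheory GRing.Theory Num.Theory.

Local Open Scope classical_set_scope.
Local Open Scope ring_scope.

(* Laws on a countable type are given by their mass functions [T -> R]. *)

(* [esum] is the supremum of the finite partial sums, so [dsum] is the sum of a
   family only when that family is nonnegative and summable; it is used for
   no other families. *)
Definition dsum (R : realType) (T : countType) (f : T -> R) : R :=
  fine (esum [set: T] (fun x => (f x)%:E)).

Definition is_pmf (R : realType) (T : countType) (mu : T -> R) : Prop :=
  (forall x, 0 <= mu x) /\ esum [set: T] (fun x => (mu x)%:E) = 1%:E.

Definition is_transition_matrix (R : realType) (T : countType)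
    (P : T -> T -> R) : Prop :=
  forall x, is_pmf (P x).

Fixpoint chain_law (R : realType) (T : countType) (P : T -> T -> R)
    (x : T) (t : nat) : T -> R :=
  if t is s.+1 then fun y => dsum (fun z => chain_law P x s z * P z y)
  else fun y => (y == x)%:R.

Definition is_equilibrium (R : realType) (T : countType)
    (P : T -> T -> R) (pi : T -> R) : Prop :=
  is_pmf pi /\ forall y, dsum (fun x => pi x * P x y) = pi y.

Definition tv_dist (R : realType) (T : countType) (mu nu : T -> R) : R :=
  dsum (fun x => `|mu x - nu x|) / 2.

Definition mixed_from (R : realType) (T : countType)
    (P : T -> T -> R) (pi : T -> R) (eps : R) (t : nat) : Prop :=
  forall (x : T) (t' : nat), (t <= t')%N ->
    tv_dist (chain_law P x t') pi <= eps.

Definition is_mixing_time (R : realType) (T : countType)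
    (P : T -> T -> R) (pi : T -> R) (eps : R) (t : nat) : Prop :=
  mixed_from P pi eps t /\
  forall s : nat, mixed_from P pi eps s -> (t <= s)%N.

Record is_metric (T : Type) (d : T -> T -> nat) : Prop := IsMetric {
  metric_eq0 : forall x y, d x y = 0%N <-> x = y ;
  metric_sym : forall x y, d x y = d y x ;
  metric_triangle : forall x y z, (d x z <= d x y + d y z)%N }.

Definition is_diameter (T : Type) (d : T -> T -> nat) (D : nat) : Prop :=
  (forall x y, (d x y <= D)%N) /\ exists x y, d x y = D.

(* [x :: s] is a path of pairs in [S] from [x] to [y]. *)
Definition joins (T : countType) (S : rel T) (x : T) (s : seq T) (y : T) :
    Prop :=
  path S x s /\ last x s = y.

Definition path_length (T : Type) (d : T -> T -> nat) (x : T) (s : seq T) :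
    nat :=
  sumn (pairmap d x s).

Record path_metric (T : countType) (S : rel T) (d : T -> T -> nat) : Prop :=
  PathMetric {
    pm_distinct : forall x y, S x y -> x != y ;
    pm_attained :
      forall x y, exists2 s, joins S x s y & path_length d x s = d x y ;
    pm_minimal :
      forall x y s, joins S x s y -> (d x y <= path_length d x s)%N }.

(* Joint one-step law of the two end points of the path [x :: s]: draw the new
   position of [x], then the new position of each vertex of [s] in turn, from
   the coupling of the edge leading to it, conditioned on the new position of
   the preceding vertex. Only the two ends are retained. When [Q] is a coupling,
   [Q (x, z) (_, w) <= P z w], so the convention [a / 0 = 0] is harmless. *)
Fixpoint compose_coupling (R : realType) (T : countType) (P : T -> T -> R)
    (Q : T * T -> T * T -> R) (x : T) (s : seq T) : T * T -> R :=
  if s is z :: s' then fun u =>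
    dsum (fun w => Q (x, z) (u.1, w) *
                   (compose_coupling P Q z s' (w, u.2) / P z w))
  else fun u => if u.1 == u.2 then P x u.1 else 0.

Record is_path_coupling (R : realType) (T : countType) (P : T -> T -> R)
    (S : rel T) (Q : T * T -> T * T -> R) : Prop := IsPathCoupling {
  pc_transition : is_transition_matrix Q ;
  pc_left : forall x y x', dsum (fun y' => Q (x, y) (x', y')) = P x x' ;
  pc_right : forall x y y', dsum (fun x' => Q (x, y) (x', y')) = P y y' ;
  pc_equal : forall x x' y', x' != y' -> Q (x, x) (x', y') = 0 ;
  pc_extend : forall x y, x != y -> ~~ S x y ->
    exists2 s, joins S x s y & Q (x, y) =1 compose_coupling P Q x s }.

(* [Pr z] is the law under which the chain [Z] with transition matrix [Q]
   starts at [z]. The last field is the Markov property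
   Pr[Z_(n+1) = h_(n+1) | Z_0 = h_0, ..., Z_n = h_n] = Q h_n h_(n+1),
   multiplied out so as to cover conditioning events of probability 0. *)
Record is_markov_process (R : realType) (disp : measure_display)
    (W : measurableType disp) (T : countType) (Q : T -> T -> R)
    (Z : nat -> W -> T) (Pr : T -> probability W R) : Prop :=
  IsMarkovProcess {
    mp_measurable : forall t z, measurable [set w | Z t w = z] ;
    mp_start : forall z, Pr z [set w | Z 0%N w = z] = 1%E ;
    mp_step : forall z n (h : nat -> T),
      Pr z [set w | forall i, (i <= n.+1)%N -> Z i w = h i] =
      (Pr z [set w | forall i, (i <= n)%N -> Z i w = h i] *
       (Q (h n) (h n.+1))%:E)%E }.

Definition dist_at (T : Type) (W : Type) (d : T -> T -> nat)
    (X Y : nat -> W -> T) (t : nat) (w : W) : nat :=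
  d (X t w) (Y t w).

(* The stopping time T_t; [None] stands for an infinite value. *)
Definition stop_time (T : Type) (W : Type) (d : T -> T -> nat)
    (X Y : nat -> W -> T) (t : nat) (w : W) : option nat :=
  match pselect (exists t', (t < t')%N &&
                   (dist_at d X Y t' w != dist_at d X Y t w)) with
  | left ex => Some (ex_minn ex)
  | right _ => None
  end.

(* The distance at time T_t. If T_t is infinite the distance keeps its value at
   time t forever, and that is the value taken. *)
Definition dist_at_stop (T : Type) (W : Type) (d : T -> T -> nat)
    (X Y : nat -> W -> T) (t : nat) (w : W) : nat :=
  if stop_time d X Y t w is Some t' then dist_at d X Y t' w
  else dist_at d X Y t w.

Definition before_stop (T : Type) (W : Type) (d : T -> T -> nat)
    (X Y : nat -> W -> T) (t t' : nat) (w : W) : Prop :=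
  if stop_time d X Y t w is Some u then (t' < u)%N else True.

(* Almost surely, a pair in [S] stays in [S] until its distance changes. *)
Definition stays_until_stop (R : realType) (disp : measure_display)
    (W : measurableType disp) (T : countType) (S : rel T) (d : T -> T -> nat)
    (X Y : nat -> W -> T) (Pr : T * T -> probability W R) : Prop :=
  forall z : T * T, {ae Pr z, forall w, forall t t' : nat,
    S (X t w) (Y t w) -> (t < t')%N -> before_stop d X Y t t' w ->
    S (X t' w) (Y t' w)}.

(* Main.v *)
Require Import Defs.
From mathcomp Require Import all_boot all_order all_algebra.
From mathcomp Require Import all_classical all_reals all_analysis.
From mathcomp Require Import measurable_realfun ring lra.

(** Path coupling is used here in its dual form. For [f : Omega -> [0, 1]] let
    [P^t f x] be the expectation of [f] at time [t] from [x]. Since distinct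
    states are at distance at least 1, [f x <= f y + d x y], and the theorem
    follows from the geometric decay of this Lipschitz bound,

      P^t f x <= P^t f y + theta^(t %/ k) * d x y / (1 - alpha),
      where theta = 1 - p (1 - alpha)                    ([iterate_lipschitz]).

    By summing along a shortest path it is enough to prove it for pairs in [S].
    Such a pair is followed until its distance changes, at time [T], and the
    bound for a smaller time is then applied to the new pair.

    The distance alone need not contract over [k] steps: all of the expected
    new distance may be produced in the first [k] steps, while the event
    [T > k], on which the old distance remains, has probability up to [1 - p].
    The remedy is to count the future distance beforehand. Let [r z <= alpha]
    be the expectation of [d_T / d_0] from a pair [z] in [S], and give [z] the
    potential [d z * (1 + r z / (1 - alpha))], which lies between [d z] and
    [d z / (1 - alpha)]. As long as the pair waits, the part of the potential
    due to [r] is preserved in expectation; when its distance changes, that part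
    pays for the potential of the new pair, which is at most
    [d_T / (1 - alpha)]. The other part, [d z], remains only if [T > k]. So
    [k] steps decrease the potential by at least [p * d z], hence by a factor
    [theta] ([potential_contraction]).

    The expectations before [T] are defined by recursion on the number of steps
    ([until_change]). A sum over the cylinder events of the process compares
    them with the probability and the expectation in the hypotheses
    ([until_change_le_integral]).

    Total variation is attained by an indicator function, so that the decay
    bounds the distance to equilibrium ([tv_dist_equilibrium_le]). In the
    closed form the factor [e] absorbs the rounding of [t / k] to an
    integer. *)

Set Implicit Arguments.
Unset Strict Implicit.
Unset Printing Implicit Defensive.

Import Order.TTheory GRing.Theory Num.Theory.

Local Open Scope classical_set_scope.
Local Open Scope ring_scope.

(** * Expectations under a mass function *)

Definition mean (R : realType) (T : countType) (mu f : T -> R) : R :=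
  dsum (fun x => mu x * f x).

Definition bounded_ge0 (R : realType) (T : Type) (f : T -> R) : Prop :=
  exists B : R, forall x, 0 <= f x <= B.

Section Mean.
Context {R : realType}.
Implicit Types T : countType.

Lemma esumZl T (c : R) (a : T -> \bar R) : 0 <= c ->
  (forall x, (0 <= a x)%E) ->
  (\esum_(x in [set: T]) (c%:E * a x) = c%:E * \esum_(x in [set: T]) a x)%E.
Proof.
move=> c0 a0.
have le_scaled (b : R) (g : T -> \bar R) : 0 <= b -> (forall x, (0 <= g x)%E) ->
    (\esum_(x in [set: T]) (b%:E * g x) <= b%:E * \esum_(x in [set: T]) g x)%E.
  move=> b0 g0; apply: ge_ereal_sup => _ [F [finF _]] <-.
  rewrite -ge0_mule_fsumr//; apply: lee_wpmul2l; first by rewrite lee_fin.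
  by apply: ereal_sup_ubound; exists F => //; split.
apply/eqP; rewrite eq_le le_scaled//=.
have [->|c_neq0] := eqVneq c 0.
  by rewrite mul0e; apply: esum_ge0 => x _; rewrite mul0e.
have c_gt0 : 0 < c by rewrite lt_neqAle eq_sym c_neq0.
rewrite -lee_pdivlMl//.
under [X in (X <= _)%E]eq_esum => x _.
  rewrite -[a x]mul1e -(mulVf c_neq0) EFinM -muleA; over.
apply: le_scaled => [|x]; first by rewrite invr_ge0.
by rewrite mule_ge0// lee_fin.
Qed.

Lemma pmf_le1 T (mu : T -> R) x : is_pmf mu -> mu x <= 1.
Proof.
move=> [mu0 mu1]; rewrite -lee_fin -mu1; apply: esum_ge.
by exists [set x]; [split|rewrite fsbig_set1].
Qed.

Lemma meanE T (mu f : T -> R) : is_pmf mu -> bounded_ge0 f ->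
  ((mean mu f)%:E = \esum_(x in [set: T]) (mu x * f x)%:E)%E.
Proof.
move=> [mu0 mu1] [B fB]; rewrite /mean /dsum fineK// ge0_fin_numE; last first.
  by apply: esum_ge0 => x _; rewrite lee_fin mulr_ge0//; case/andP: (fB x).
apply: (@le_lt_trans _ _ (\esum_(x in [set: T]) (`|B|%:E * (mu x)%:E))%E).
  apply: le_esum => x _; rewrite -EFinM lee_fin mulrC ler_wpM2r//.
  by apply: le_trans (ler_norm B); case/andP: (fB x).
by rewrite esumZl// mu1 mule1 ltry.
Qed.

Lemma bounded_ge0_cst T (c : R) : 0 <= c -> bounded_ge0 (fun _ : T => c).
Proof. by move=> c0; exists c => x; rewrite c0 lexx. Qed.

Lemma bounded_ge0D T (f g : T -> R) :
  bounded_ge0 f -> bounded_ge0 g -> bounded_ge0 (fun x => f x + g x).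
Proof.
move=> [B fB] [C gC]; exists (B + C) => x.
by have /andP[f0 fb] := fB x; have /andP[g0 gb] := gC x; rewrite addr_ge0 ?lerD.
Qed.

Lemma bounded_ge0Z T (c : R) (f : T -> R) :
  0 <= c -> bounded_ge0 f -> bounded_ge0 (fun x => c * f x).
Proof.
move=> c0 [B fB]; exists (c * B) => x.
by have /andP[f0 fb] := fB x; rewrite mulr_ge0 ?ler_wpM2l.
Qed.

Lemma mean_ge0 T (mu f : T -> R) : is_pmf mu -> bounded_ge0 f ->
  0 <= mean mu f.
Proof.
move=> pm bf; rewrite -lee_fin meanE//; apply: esum_ge0 => x _.
by rewrite lee_fin mulr_ge0//; [case: pm|case: bf => B /(_ x)/andP[]].
Qed.

Lemma le_mean T (mu f g : T -> R) : is_pmf mu ->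
    bounded_ge0 f -> bounded_ge0 g -> (forall x, 0 < mu x -> f x <= g x) ->
  mean mu f <= mean mu g.
Proof.
move=> pm bf bg fg; rewrite -lee_fin !meanE//; apply: le_esum => x _.
have [mu0 _] := pm; rewrite lee_fin.
have [->|mux] := eqVneq (mu x) 0; first by rewrite !mul0r.
by rewrite ler_wpM2l// fg// lt_neqAle eq_sym mux mu0.
Qed.

Lemma meanD T (mu f g : T -> R) : is_pmf mu ->
  bounded_ge0 f -> bounded_ge0 g ->
  mean mu (fun x => f x + g x) = mean mu f + mean mu g.
Proof.
move=> pm bf bg; apply: EFin_inj; rewrite EFinD !meanE//; last first.
  exact: bounded_ge0D.
have [mu0 _] := pm; case: bf => B fB; case: bg => C gC.
rewrite -esumD => [|x _|x _]; first last.
- by rewrite lee_fin mulr_ge0//; case/andP: (gC x).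
- by rewrite lee_fin mulr_ge0//; case/andP: (fB x).
by apply: eq_esum => x _; rewrite mulrDr EFinD.
Qed.

Lemma meanZ T (mu f : T -> R) (c : R) : is_pmf mu -> 0 <= c ->
  bounded_ge0 f -> mean mu (fun x => c * f x) = c * mean mu f.
Proof.
move=> pm c0 bf; apply: EFin_inj; rewrite EFinM !meanE//; last first.
  exact: bounded_ge0Z.
have [mu0 _] := pm; case: bf => B fB.
rewrite -esumZl// => [|x]; last first.
  by rewrite lee_fin mulr_ge0//; case/andP: (fB x).
by apply: eq_esum => x _; rewrite mulrCA EFinM.
Qed.

Lemma mean_cst T (mu : T -> R) (c : R) : is_pmf mu -> 0 <= c ->
  mean mu (fun=> c) = c.
Proof.
move=> [mu0 mu1] c0; rewrite /mean /dsum.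
under eq_esum => x _ do rewrite mulrC EFinM.
by rewrite esumZl// mu1 mule1.
Qed.

Lemma mean_between T (mu f : T -> R) (B : R) : is_pmf mu ->
  (forall x, 0 <= f x <= B) -> 0 <= mean mu f <= B.
Proof.
move=> pm fB.
have bf : bounded_ge0 f by exists B.
rewrite mean_ge0//=.
have [x0|noT] := pselect (exists x0 : T, True); last first.
  case: pm => _; rewrite esum1 => [/eqP|x]; last by case: noT; exists x.
  by rewrite eq_sym eqe oner_eq0.
have B0 : 0 <= B by case: x0 => x _; case/andP: (fB x) => /le_trans; apply.
rewrite -[leRHS](mean_cst pm)//; apply: le_mean => //.
  exact: bounded_ge0_cst.
by move=> x _; case/andP: (fB x).
Qed.

Lemma exchange_esum (T1 T2 : countType) (a : T1 -> T2 -> \bar R) :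
    (forall x y, (0 <= a x y)%E) ->
  (\esum_(x in [set: T1]) \esum_(y in [set: T2]) a x y =
   \esum_(y in [set: T2]) \esum_(x in [set: T1]) a x y)%E.
Proof.
move=> a0; rewrite !esum_esum//.
rewrite (reindex_esum ([set: T2] `*`` fun=> [set: T1])
                      _ (fun z => (z.2, z.1)))//.
split=> [//|[x y] [x' y'] _ _ [-> ->]//|[x y] _].
by exists (y, x).
Qed.

(** The tower property. It serves for the law of the chain at successive times
    and for the invariance of an equilibrium. *)
Lemma mixture_mean (T1 T2 : countType) (mu : T1 -> R) (K : T1 -> T2 -> R)
    (nu : T2 -> R) :
    is_pmf mu -> (forall x, is_pmf (K x)) ->
    (forall y, nu y = dsum (fun x => mu x * K x y)) ->
  is_pmf nu /\
  forall f, bounded_ge0 f -> mean nu f = mean mu (fun x => mean (K x) f).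
Proof.
move=> pm pK nuE.
have bK y : bounded_ge0 (fun x => K x y).
  by exists 1 => x; rewrite pmf_le1// andbT; case: (pK x).
have nuEE y : ((nu y)%:E = \esum_(x in [set: T1]) (mu x * K x y)%:E)%E.
  by rewrite nuE [dsum _]/(mean _ _) meanE.
have mu0 := pm.1.
have K0 x y : 0 <= K x y by case: (pK x).
have nu0 y : 0 <= nu y.
  by rewrite nuE; apply: (@mean_ge0 _ _ (fun x => K x y)).
have key f : bounded_ge0 f -> (\esum_(y in [set: T2]) (nu y * f y)%:E =
     (mean mu (fun x => mean (K x) f))%:E)%E.
  move=> [B fB].
  have f0 y : 0 <= f y by case/andP: (fB y).
  have bf : bounded_ge0 f by exists B.
  rewrite meanE//; last by exists B => x; apply: mean_between.
  under [RHS]eq_esum => x _.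
    rewrite EFinM meanE// -esumZl//; last by move=> y; rewrite lee_fin mulr_ge0.
  over.
  rewrite [RHS]exchange_esum; last first.
    by move=> x y; rewrite mule_ge0// lee_fin// mulr_ge0.
  apply: eq_esum => y _.
  rewrite mulrC EFinM nuEE -esumZl//.
    by apply: eq_esum => x _; rewrite -!EFinM; congr (_%:E); lra.
  by move=> x; rewrite lee_fin mulr_ge0.
have pn : is_pmf nu.
  split=> //.
  have := key (fun=> 1) (bounded_ge0_cst _ ler01).
  under eq_esum => y _ do rewrite mulr1.
  move=> ->.
  under [fun x => mean _ _]funext => x do rewrite mean_cst//.
  by rewrite mean_cst.
by split=> // f bf; apply: EFin_inj; rewrite meanE// key.
Qed.

Lemma marginal_mean1 (T1 T2 : countType) (mu : T1 * T2 -> R) (nu : T1 -> R) g :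
    is_pmf mu -> is_pmf nu -> (forall x, dsum (fun y => mu (x, y)) = nu x) ->
    bounded_ge0 g ->
  mean nu g = mean mu (fun z => g z.1).
Proof.
move=> pm pn nuE bg; apply: EFin_inj.
have [B gB] := bg.
have g0 x : 0 <= g x by case/andP: (gB x).
have mu0 := pm.1.
rewrite !meanE//; last by exists B => z.
transitivity (\esum_(x in [set: T1]) \esum_(y in [set: T2])
    (mu (x, y) * g x)%:E)%E; last first.
  rewrite esum_esum; last by move=> x y _ _; rewrite lee_fin mulr_ge0.
  rewrite (_ : _ `*`` _ = [set: T1 * T2]); last by apply/seteqP; split.
  by apply: eq_esum => -[x y].
apply: eq_esum => x _.
under [RHS]eq_esum => y _ do rewrite mulrC EFinM.
rewrite esumZl => [|//|y]; last by rewrite lee_fin.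
rewrite [nu x * _]mulrC EFinM -nuE /dsum fineK//.
rewrite ge0_fin_numE; last by apply: esum_ge0 => y _; rewrite lee_fin.
apply: (@le_lt_trans _ _ 1%E); last exact: ltry.
rewrite -pm.2.
(* The mass of the fiber over [x] is part of the total mass. *)
rewrite -(@esum_image R T2 (T1 * T2)%type setT (fun y => (x, y))
  (fun z => (mu z)%:E)); last by move=> y y' _ _ [].
rewrite esum_mkcond; apply: le_esum => z _.
by case: ifP => // _; rewrite lee_fin.
Qed.

Lemma marginal_mean2 (T1 T2 : countType) (mu : T1 * T2 -> R) (nu : T2 -> R) g :
    is_pmf mu -> is_pmf nu -> (forall y, dsum (fun x => mu (x, y)) = nu y) ->
    bounded_ge0 g ->
  mean nu g = mean mu (fun z => g z.2).
Proof.
move=> pm pn nuE bg.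
have swap (a : T1 * T2 -> \bar R) : (\esum_(z in [set: T1 * T2]) a z =
    \esum_(z in [set: T2 * T1]) a (z.2, z.1))%E.
  apply: reindex_esum; split=> [//|[x y] [x' y'] _ _ [-> ->]//|[x y] _].
  by exists (y, x).
have pm' : is_pmf (fun z : T2 * T1 => mu (z.2, z.1)).
  by split=> [z|]; [apply: pm.1|rewrite -(swap (fun z => (mu z)%:E)) pm.2].
rewrite (marginal_mean1 pm')// /mean /dsum; congr fine.
by rewrite [RHS]swap.
Qed.

End Mean.

(** * The chain acting on functions *)

Definition advance (R : realType) (T : countType) (P : T -> T -> R)
    (f : T -> R) : T -> R :=
  fun x => mean (P x) f.

Section Chain.
Context {R : realType} {T : countType} (P : T -> T -> R).
Context (hP : is_transition_matrix P).

Lemma advance_between t (f : T -> R) (B : R) :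
  (forall x, 0 <= f x <= B) -> forall x, 0 <= iter t (advance P) f x <= B.
Proof. by move=> fB; elim: t => // t IH x; apply: mean_between. Qed.

Lemma chain_law_mean t x :
  is_pmf (chain_law P x t) /\
  forall f, bounded_ge0 f -> mean (chain_law P x t) f = iter t (advance P) f x.
Proof.
elim: t => [|t [pt IH]].
  have sum_at (f : T -> R) : (forall y, 0 <= f y) ->
      (\esum_(y in [set: T]) ((y == x)%:R * f y)%:E = (f x)%:E)%E.
    move=> f0; transitivity (\esum_(y in [set x]) (f y)%:E)%E; last first.
      by rewrite esum_set1// lee_fin.
    rewrite [RHS]esum_mkcond; apply: eq_esum => y _.
    rewrite in_set1; have [->|_] := eqVneq y x; rewrite ?mul1r ?mul0r//.
  have px : is_pmf (chain_law P x 0).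
    split=> [y|/=]; first exact: ler0n.
    rewrite -(sum_at (fun=> 1))//; apply: eq_esum => y _; rewrite mulr1//.
  split=> // f bf; apply: EFin_inj; rewrite meanE//= sum_at// => y.
  by case: bf => B /(_ y)/andP[].
have [pS meanS] := mixture_mean pt hP (fun y => erefl (chain_law P x t.+1 y)).
split=> // f bf; rewrite meanS// iterSr -IH//.
by case: bf => B fB; exists B => y; apply: mean_between.
Qed.

Lemma equilibrium_mean (pi : T -> R) t f :
  is_equilibrium P pi -> bounded_ge0 f ->
  mean pi (iter t (advance P) f) = mean pi f.
Proof.
move=> [ppi piP] [B fB].
have [_ meanP] := mixture_mean ppi hP (fun y => esym (piP y)).
elim: t => // t <- /=; rewrite [RHS]meanP//.
by exists B; apply: advance_between.
Qed.

(** The set where [mu] exceeds [nu] attains the total variation distance. *)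
Lemma tv_distE (mu nu : T -> R) : is_pmf mu -> is_pmf nu ->
  let f y := (nu y < mu y)%R%:R in tv_dist mu nu = mean mu f - mean nu f.
Proof.
move=> pm pn f.
have f01 y : 0 <= f y <= 1.
  by rewrite /f; case: (nu y < mu y); rewrite ?lexx ler01.
have bf : bounded_ge0 f by exists 1.
have mu0 := pm.1; have nu0 := pn.1.
have f0 y : 0 <= f y by case/andP: (f01 y).
(* At each state, both sides of this identity agree. Every term is nonnegative,
   so the sums can be handled without subtraction. *)
have bal : (\esum_(y in [set: T]) (`|mu y - nu y|)%:E
      + (\esum_(y in [set: T]) (nu y * f y)%:E
      + \esum_(y in [set: T]) (nu y * f y)%:E)
      + \esum_(y in [set: T]) (mu y)%:E
    = \esum_(y in [set: T]) (mu y * f y)%:E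
      + \esum_(y in [set: T]) (mu y * f y)%:E
      + \esum_(y in [set: T]) (nu y)%:E)%E.
  rewrite -!esumD //=; do ?by move=> y _; rewrite ?adde_ge0// lee_fin ?mulr_ge0.
  apply: eq_esum => y _; rewrite -!EFinD; congr (_%:E).
  rewrite /f; case: ltP => [lt_nu|le_mu].
    by rewrite gtr0_norm ?subr_gt0//=; lra.
  by rewrite ler0_norm ?subr_le0//=; lra.
move: bal; rewrite pm.2 pn.2 -!meanE// /tv_dist /dsum.
set s := esum _ _.
have s0 : (0 <= s)%E by apply: esum_ge0 => y _; rewrite lee_fin.
case: s s0 => [s|_|//]; last by rewrite !addye//= -?EFinD.
rewrite lee_fin -!EFinD => _ [] /=; lra.
Qed.

(** Averaging over an equilibrium starting state [y] turns the comparison of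
    two starting states into a comparison with [pi]. *)
Lemma tv_dist_equilibrium_le (pi : T -> R) (delta : R) t x :
    is_equilibrium P pi -> 0 <= delta ->
    (forall f, (forall z, 0 <= f z <= 1) -> forall y,
       iter t (advance P) f x <= iter t (advance P) f y + delta) ->
  tv_dist (chain_law P x t) pi <= delta.
Proof.
move=> eqpi delta0 close; have [pt meant] := chain_law_mean t x.
have ppi := eqpi.1.
rewrite tv_distE//; set f := fun y => _.
have f01 y : 0 <= f y <= 1.
  by rewrite /f; case: (pi y < chain_law P x t y); rewrite ?lexx ler01.
have bf : bounded_ge0 f by exists 1.
have bft : bounded_ge0 (iter t (advance P) f).
  by exists 1; apply: advance_between.
have bc c : 0 <= c -> bounded_ge0 (fun _ : T => c) by apply: bounded_ge0_cst.
rewrite meant// -(equilibrium_mean t eqpi bf) lerBlDl.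
have /andP[ftx0 _] := advance_between t f01 x.
rewrite -(mean_cst ppi ftx0) addrC -[delta](mean_cst ppi delta0) addrC -meanD//;
  last exact: bc.
apply: le_mean => //; first exact: bc.
  by apply: bounded_ge0D => //; apply: bc.
by move=> y _; apply: close.
Qed.

End Chain.

(** * Contraction of the potential *)

Definition pair_dist (T : Type) (d : T -> T -> nat) (z : T * T) : nat :=
  d z.1 z.2.

(** For the chain [Z] with transition matrix [Q] started at [z], let [t] be the
    first time with [v (Z t) != v z]. This is the expectation of the reward
    [gain (Z (t - 1)) (Z t)] if [t <= n], and of [init] otherwise. *)
Fixpoint until_change (R : realType) (T : countType) (Q : T -> T -> R)
    (v : T -> nat) (init : R) (gain : T -> T -> R) (n : nat) (z : T) : R :=
  if n is n'.+1 then
    mean (Q z) (fun z' => if v z' == v z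
                          then until_change Q v init gain n' z' else gain z z')
  else init.

Lemma until_change_bounded (R : realType) (T : countType) (Q : T -> T -> R)
    (v : T -> nat) (init : R) (gain : T -> T -> R) (B : R) :
    is_transition_matrix Q -> 0 <= init <= B ->
    (forall z z', 0 <= gain z z' <= B) ->
  forall n z, 0 <= until_change Q v init gain n z <= B.
Proof.
move=> hQ initB gainB; elim=> //= n IH z; apply: mean_between => // z'.
by case: ifP.
Qed.

Section Contraction.
Context {R : realType} {T : countType}.
Context (P : T -> T -> R) (Q : T * T -> T * T -> R) (S : rel T).
Context (d : T -> T -> nat) (D : nat).
Context (hP : is_transition_matrix P) (hQ : is_path_coupling P S Q).
Context (hd : is_metric d) (hS : path_metric S d).
Context (dD : forall x y, (d x y <= D)%N).

Let dist := pair_dist d.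

(** The probability of [T > n], where [T] is the first time at which the distance
    is not the initial one. *)
Definition survival (n : nat) (z : T * T) : R :=
  until_change Q (pair_dist d) 1 (fun _ _ => 0) n z.

(** The expectation of [d_T / d_0] restricted to [T <= n]. The ratio of
    consecutive distances can be used, because the distance just before [T] is
    still [d_0]. *)
Definition exit_ratio (n : nat) (z : T * T) : R :=
  until_change Q (pair_dist d) 0
    (fun z z' => (pair_dist d z')%:R / (pair_dist d z)%:R) n z.

Lemma survival_bounded n : bounded_ge0 (survival n).
Proof.
exists 1; apply: until_change_bounded; [exact: pc_transition hQ| |].
  by rewrite ler01 lexx.
by move=> *; rewrite lexx ler01.
Qed.

Lemma dist_ratio_le z z' : 0 <= ((dist z')%:R / (dist z)%:R : R) <= D%:R.
Proof.
rewrite divr_ge0//=.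
case: (dist z) => [|n]; first by rewrite invr0 mulr0.
rewrite ler_pdivrMr ?ltr0n// -natrM ler_nat.
by apply: leq_trans (dD z'.1 z'.2) _; rewrite leq_pmulr.
Qed.

Lemma exit_ratio_bounded n : bounded_ge0 (exit_ratio n).
Proof.
exists D%:R; apply: until_change_bounded; [exact: pc_transition hQ| |].
  by rewrite lexx ler0n.
exact: dist_ratio_le.
Qed.

(** This is where path coupling saves work: shortest paths consist of edges, so
    a Lipschitz bound on the edges is a global one. *)
Lemma path_lipschitz (g : T -> R) (K : R) : 0 <= K ->
    (forall x y, S x y -> g x <= g y + K * (d x y)%:R) ->
  forall x y, g x <= g y + K * (d x y)%:R.
Proof.
move=> K0 gS x y; have [s [Ss <-] <-] := pm_attained hS x y.
rewrite /path_length; elim: s x Ss => [|z s IH] x /=.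
  by rewrite mulr0 addr0.
move=> /andP[Sxz Ss]; rewrite natrD mulrDr addrCA.
apply: le_trans (gS _ _ Sxz) _; rewrite [leLHS]addrC lerD2l; exact: IH.
Qed.

Context (k : nat) (p alpha : R).
Context (p0 : 0 <= p) (p1 : p <= 1) (alpha0 : 0 <= alpha) (alpha1 : alpha < 1).
Context (stay : forall z z', S z.1 z.2 -> 0 < Q z z' -> dist z' = dist z ->
  S z'.1 z'.2).
Context (exit_le : forall n z, S z.1 z.2 -> exit_ratio n z <= alpha).
Context (survival_le : forall z, S z.1 z.2 -> survival k z <= 1 - p).

Let theta : R := 1 - p * (1 - alpha).
Let c : R := (1 - alpha)^-1.

Let theta_ge0 : 0 <= theta.
Proof.
rewrite subr_ge0 -[leRHS]mulr1; apply: ler_pM => //.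
  by rewrite subr_ge0 ltW.
by rewrite gerBl.
Qed.

Let c_ge0 : 0 <= c.
Proof. by rewrite invr_ge0 subr_ge0 ltW. Qed.

Let cE : 1 + c * alpha = c.
Proof. by rewrite /c; field; rewrite subr_eq0 gt_eqF. Qed.

(** The decay statement for an edge after [m] blocks of [k] steps and [j] further
    steps. At [j = 0] the survival factor is 1 and the bound is [theta ^+ m]
    times the potential. The horizon of [exit_ratio] is the number of steps
    that are still to be made, so that one step of the recursion defining
    [exit_ratio] matches one step of the chain. *)
Definition potential_contracts (m j : nat) : Prop :=
  forall f, (forall x, 0 <= f x <= 1) -> forall x y, S x y ->
    iter (j + m * k) (advance P) f x <= iter (j + m * k) (advance P) f y +
      theta ^+ m * ((d x y)%:R *
        (survival j (x, y) + c * exit_ratio (j + m * k) (x, y))).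

(** [1 + c * alpha = c], so that the potential of an edge is at most [c] times
    its length. *)
Lemma potential_lipschitz m : potential_contracts m 0 ->
  forall f, (forall x, 0 <= f x <= 1) -> forall x y,
    iter (m * k) (advance P) f x <= iter (m * k) (advance P) f y +
      theta ^+ m * c * (d x y)%:R.
Proof.
move=> hm f f01; apply: path_lipschitz => [|x y Sxy].
  by rewrite mulr_ge0// exprn_ge0.
apply: le_trans (hm f f01 x y Sxy) _; rewrite lerD2l -mulrA.
rewrite ler_wpM2l ?exprn_ge0// [leRHS]mulrC ler_wpM2l//.
by rewrite -[leRHS]cE lerD2l ler_wpM2l// exit_le.
Qed.

(** First-step analysis. If the distance is unchanged, the pair is still an edge
    and the bound for [j] applies; otherwise the new pair, which may be
    arbitrary, is bounded by [c] times its distance, and this is the share of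
    [c * exit_ratio] belonging to it. *)
Lemma potential_step m j :
  potential_contracts m 0 -> potential_contracts m j ->
  potential_contracts m j.+1.
Proof.
move=> h0 hj f f01 x y Sxy; rewrite addSn !iterS.
set n := (j + m * k)%N; set g := iter n (advance P) f.
set z := (x, y).
have hQz := pc_transition hQ z.
have g01 : forall x, 0 <= g x <= 1 by apply: advance_between.
have bg : bounded_ge0 g by exists 1.
have bg2 : bounded_ge0 (fun z' : T * T => g z'.2) by exists 1.
have dz0 : (d x y)%:R != 0 :> R.
  rewrite pnatr_eq0; apply: contraNneq (pm_distinct hS Sxy).
  by move/(metric_eq0 hd x y)->.
have bif (F G : T * T -> R) : bounded_ge0 F -> bounded_ge0 G ->
    bounded_ge0 (fun z' => if dist z' == dist z then F z' else G z').
  move=> [B FB] [C GC]; exists (B + C) => z'.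
  have /andP[F0 FB'] := FB z'; have /andP[G0 GC'] := GC z'.
  have /andP[_ FB''] := FB z; have /andP[F0'' _] := FB z.
  have /andP[_ GC''] := GC z; have /andP[G0'' _] := GC z.
  by case: ifP => _; apply/andP; split; lra.
pose A z' := if dist z' == dist z then survival j z' else 0.
pose B z' := if dist z' == dist z then exit_ratio n z'
             else (dist z')%:R / (dist z)%:R.
have bA : bounded_ge0 A.
  by apply: bif; [exact: survival_bounded|exact: bounded_ge0_cst].
have bB : bounded_ge0 B.
  apply: bif; first exact: exit_ratio_bounded.
  by exists D%:R => z'; exact: dist_ratio_le.
have bcB : bounded_ge0 (fun z' => c * B z') by apply: bounded_ge0Z.
have bAB : bounded_ge0 (fun z' => A z' + c * B z') by apply: bounded_ge0D.
have K0 : 0 <= theta ^+ m * (d x y)%:R by rewrite mulr_ge0// exprn_ge0.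
have bE : bounded_ge0 (fun z' => theta ^+ m * (d x y)%:R * (A z' + c * B z')).
  exact: bounded_ge0Z.
have -> : advance P g x = mean (Q z) (fun z' => g z'.1).
  by apply: marginal_mean1 => //; apply: pc_left hQ x y.
have -> : advance P g y = mean (Q z) (fun z' => g z'.2).
  by apply: marginal_mean2 => //; apply: pc_right hQ x y.
have -> : survival j.+1 z = mean (Q z) A by [].
have -> : exit_ratio n.+1 z = mean (Q z) B by [].
rewrite mulrA -meanZ// -meanD// -meanZ// -meanD//.
apply: le_mean => //; [by exists 1 => z'|exact: bounded_ge0D|].
move=> z' Qz'; rewrite /A /B.
have [dz'|dz'] := eqVneq (dist z') (dist z).
  have Sz' := stay (z := z) Sxy Qz' dz'.
  have := hj f f01 z'.1 z'.2 Sz'; rewrite -surjective_pairing mulrA.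
  by rewrite [X in X%:R]dz'.
have := potential_lipschitz h0 (advance_between hP j f01) z'.1 z'.2.
rewrite -!iterD [(m * k + j)%N]addnC -/n -/g => /le_trans; apply.
rewrite lerD2l add0r.
rewrite -!mulrA ler_wpM2l ?exprn_ge0// mulrCA ler_wpM2l//.
by rewrite mulrCA divff ?mulr1.
Qed.

(** After [k] steps the survival factor is at most [1 - p], so the potential
    [d * (1 + c * r)] has decreased by [p * d >= p * (1 - alpha) * potential]. *)
Lemma potential_contraction m : potential_contracts m 0.
Proof.
elim: m => [|m IH].
  move=> f f01 x y Sxy.
  rewrite /survival /exit_ratio /= expr0 mul1r mulr0 addr0 mulr1.
  have d1 : 1 <= (d x y)%:R :> R.
    rewrite ler1n lt0n; apply: contraNneq (pm_distinct hS Sxy).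
    by move/(metric_eq0 hd x y)->.
  have /andP[_ fx] := f01 x; have /andP[fy _] := f01 y; lra.
have step j : potential_contracts m j.
  by elim: j => // j; apply: potential_step.
move=> f f01 x y Sxy; have := step k f f01 x y Sxy; rewrite -mulSn => /le_trans.
apply; rewrite lerD2l exprSr -[leRHS]mulrA ler_wpM2l ?exprn_ge0// [leRHS]mulrCA.
rewrite ler_wpM2l//.
have h := exit_le (m.+1 * k) (z := (x, y)) Sxy.
have s := survival_le (z := (x, y)) Sxy.
rewrite add0n.
set r := exit_ratio _ _ in h *.
have cr : 1 + c * r <= c by rewrite -[leRHS]cE lerD2l ler_wpM2l.
have pc1 : p * (1 - alpha) * (1 + c * r) <= p.
  rewrite -[leRHS]mulr1 -mulrA ler_wpM2l//.
  apply: (@le_trans _ _ ((1 - alpha) * c)).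
    by rewrite ler_wpM2l// subr_ge0 ltW.
  by rewrite divff// subr_eq0 gt_eqF.
have -> : survival 0 (x, y) = 1 by [].
rewrite /theta.
move: s pc1; move: (survival k _) (p * _) (c * r) => u q v; lra.
Qed.

Lemma iterate_lipschitz f t x y : (forall x, 0 <= f x <= 1) ->
  iter t (advance P) f x <= iter t (advance P) f y +
    theta ^+ (t %/ k) * c * (d x y)%:R.
Proof.
move=> f01.
(* The other [t %% k] steps only replace [f] by a function that is again between
   0 and 1. *)
rewrite {1 2}(divn_eq t k) !iterD.
apply: (potential_lipschitz (@potential_contraction _)).
exact: advance_between.
Qed.

End Contraction.

(** * From the process to the recursion *)

Lemma measurable_fibers (disp : measure_display) (W : measurableType disp)
    (T : countType) (A : W -> T) (E : set T) :
  (forall t, measurable [set w | A w = t]) -> measurable (A @^-1` E).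
Proof.
move=> mA; rewrite (_ : _ @^-1` E =
    \bigcup_t (if pselect (E t) then [set w | A w = t] else set0)); last first.
  apply/seteqP; split=> [w Ew|w [t _]]; last by case: pselect => //= ? ->.
  by exists (A w) => //; case: pselect.
apply: countable_bigcupT_measurable => [|t]; first exact: countableP.
by case: (pselect (E t)) => Et; [exact: mA|exact: measurable0].
Qed.

Section MarkovProcess.
Context {R : realType} {disp : measure_display} {W : measurableType disp}.
Context {T : countType} (Q : T -> T -> R) (Z : nat -> W -> T).
Context (Pr : T -> probability W R).
Context (hQ : is_transition_matrix Q) (hZ : is_markov_process Q Z Pr).

Definition cylinder (n : nat) (h : nat -> T) : set W :=
  [set w | forall i, (i <= n)%N -> Z i w = h i].

Lemma measurable_cylinder n h : measurable (cylinder n h).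
Proof.
rewrite (_ : cylinder n h =
    \bigcap_(i in [set i | (i <= n)%N]) [set w | Z i w = h i]) //.
by apply: bigcap_measurableType => i _; exact: mp_measurable hZ i (h i).
Qed.

Context (v : T -> nat) (init : R) (gain : T -> T -> R) (B : R).
Context (initB : 0 <= init <= B) (gainB : forall z z', 0 <= gain z z' <= B).

Context (N : nat) (F : W -> \bar R).
Context (mF : measurable_fun [set: W] F) (F0 : forall w, (0 <= F w)%E).
(* Together, [F_init] and [F_gain] say that [F] dominates the reward collected by
   time [N] along each trajectory. *)
Context (F_init : forall w, (forall i, (i <= N)%N -> v (Z i w) = v (Z 0%N w)) ->
  (init%:E <= F w)%E).
Context (F_gain : forall w n, (n < N)%N ->
  (forall i, (i <= n)%N -> v (Z i w) = v (Z 0%N w)) ->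
  v (Z n.+1 w) != v (Z 0%N w) -> ((gain (Z n w) (Z n.+1 w))%:E <= F w)%E).

(** Given a history of length [n] without a change of [v], the expected reward of
    the remaining [j] steps is at most that of [F]. By the Markov property, the
    history splits into its one-step extensions in the proportions given by
    [Q]. *)
Lemma cylinder_until_change z j n h :
    (n + j)%N = N -> (forall i, (i <= n)%N -> v (h i) = v (h 0%N)) ->
  (Pr z (cylinder n h) * (until_change Q v init gain j (h n))%:E <=
   \int[Pr z]_(w in cylinder n h) F w)%E.
Proof.
have mFA A : measurable A -> measurable_fun A F.
  by move=> mA; apply: measurable_funS mF.
have cst_le A (b : R) : measurable A -> 0 <= b ->
    (forall w, A w -> (b%:E <= F w)%E) ->
    (Pr z A * b%:E <= \int[Pr z]_(w in A) F w)%E.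
  move=> mA b0 bF; rewrite muleC -integral_cst//.
  by apply: ge0_le_integral => //; apply: mFA.
have /andP[init0 _] := initB.
elim: j n h => [|j IH] n h.
  rewrite addn0 => -> hv; apply: cst_le => //; first exact: measurable_cylinder.
  move=> w hw; apply: F_init => i iN; rewrite !hw//; exact: hv.
move=> njN hv /=.
have mC := measurable_cylinder n h.
set G := fun z' => if _ then _ else _.
have GB z' : 0 <= G z' <= B.
  by rewrite /G; case: ifP => _ //; apply: until_change_bounded.
pose h' z' i := if (i <= n)%N then h i else z'.
have h'n z' i : (i <= n)%N -> h' z' i = h i by rewrite /h' => ->.
have h'S z' : h' z' n.+1 = z' by rewrite /h' ltnn.
have cylE z' : cylinder n (h' z') = cylinder n h.
  by apply/seteqP; split=> w hw i le_in; rewrite hw// h'n.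
have stepE z' : Pr z (cylinder n.+1 (h' z')) =
    (Pr z (cylinder n h) * (Q (h n) z')%:E)%E.
  have := mp_step hZ z n (h' z'); rewrite -/(cylinder _ _) => ->.
  by rewrite -/(cylinder _ _) cylE h'S h'n.
have sub z' : cylinder n.+1 (h' z') `<=` cylinder n h.
  by move=> w hw i le_in; rewrite hw ?h'n// leqW.
have branch z' : (Pr z (cylinder n.+1 (h' z')) * (G z')%:E <=
    \int[Pr z]_(w in cylinder n.+1 (h' z')) F w)%E.
  rewrite /G; have [vz'|vz'] := eqVneq (v z') (v (h n)).
    rewrite -{2}(h'S z'); apply: IH; first by rewrite addSnnS.
    move=> i; rewrite leq_eqVlt => /predU1P[->|]; last first.
      by rewrite ltnS => le_in; rewrite !h'n//; exact: hv.
    by rewrite h'S vz' h'n// hv.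
  apply: cst_le; [exact: measurable_cylinder|by case/andP: (gainB (h n) z')|].
  move=> w hw.
  have Zn i : (i <= n)%N -> Z i w = h i by move=> le_in; apply: sub hw _ le_in.
  have ZS : Z n.+1 w = z' by rewrite hw// h'S.
  have := @F_gain w n; rewrite ZS !Zn//; apply.
  - by rewrite -njN -addSnnS leq_addr.
  - by move=> i le_in; rewrite Zn// hv.
  - by rewrite -(hv n).
rewrite meanE//; last by exists B.
have fPr : Pr z (cylinder n h) \is a fin_num by exact: fin_num_measure.
rewrite -(fineK fPr) -esumZl//; last 2 first.
- by rewrite fine_ge0.
- move=> z'; rewrite lee_fin mulr_ge0//; first by case: (hQ (h n)).
  by case/andP: (GB z').
(* It is enough to consider finitely many extensions; these are disjoint. *)
apply: ge_ereal_sup => _ [E [finE _]] <-.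
rewrite fsbig_finite//=; set s := finmap.enum_fset _.
pose C z' := cylinder n.+1 (h' z').
apply: (@le_trans _ _ (\sum_(z' <- s) \int[Pr z]_(w in C z') F w)%E).
  apply: lee_sum => z' _; apply: le_trans (branch z').
  by rewrite fineK// EFinM muleA stepE.
have mU : measurable (\big[setU/set0]_(z' <- s) C z').
  by apply: bigsetU_measurable => z' _; exact: measurable_cylinder.
rewrite -ge0_integral_bigsetU//; last first.
- exact: mFA.
- move=> z1 z2 _ _ [w [/(_ n.+1 (leqnn _)) + /(_ n.+1 (leqnn _))]].
  by rewrite !h'S => -> .
- exact: finmap.fset_uniq.
- by move=> z'; exact: measurable_cylinder.
apply: ge0_subset_integral => //; first exact: mFA.
by move=> w; rewrite -bigcup_seq => -[z' _]; apply: sub.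
Qed.

Lemma until_change_le_integral z :
  ((until_change Q v init gain N z)%:E <= \int[Pr z]_w F w)%E.
Proof.
have := @cylinder_until_change z N 0%N (fun=> z) erefl (fun _ _ => erefl).
have -> : cylinder 0 (fun=> z) = [set w | Z 0%N w = z].
  apply/seteqP; split=> w /=; first exact.
  by move=> Zw i; rewrite leqn0 => /eqP ->.
rewrite (mp_start hZ) mul1e => /le_trans; apply.
by apply: ge0_subset_integral => //; exact: mp_measurable hZ _ _.
Qed.

End MarkovProcess.

(** * The stopping time *)

Section StoppingTime.
Context {T W : Type} (d : T -> T -> nat) (X Y : nat -> W -> T).

Variant stop_time_spec (w : W) : option nat -> Type :=
| StopAt t of (forall i, (i <= t)%N -> dist_at d X Y i w = dist_at d X Y 0 w)
    & dist_at d X Y t.+1 w != dist_at d X Y 0 w : stop_time_spec w (Some t.+1)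
| NeverStop of (forall i, dist_at d X Y i w = dist_at d X Y 0 w) :
    stop_time_spec w None.

Lemma stop_timeP w : stop_time_spec w (stop_time d X Y 0 w).
Proof.
rewrite /stop_time; case: pselect => [ex|never].
  case: ex_minnP => -[//|t] /andP[_ dt] min_t; apply: StopAt => // -[//|i] it.
  apply/eqP; apply: contraTT it => di.
  by rewrite -ltnNge min_t.
apply: NeverStop => -[//|i]; apply/eqP; apply/negPn/negP => di.
by case: never; exists i.+1.
Qed.

Lemma stop_time_eq w t :
    (forall i, (i <= t)%N -> dist_at d X Y i w = dist_at d X Y 0 w) ->
    dist_at d X Y t.+1 w != dist_at d X Y 0 w ->
  stop_time d X Y 0 w = Some t.+1.
Proof.
move=> before change.
case: stop_timeP => [s before_s change_s|never]; last first.
  by rewrite never eqxx in change.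
suff -> : s = t by [].
apply/eqP; rewrite eqn_leq; apply/andP; split; rewrite leqNgt.
  by apply: contraNN change => /before_s ->.
by apply: contraNN change_s => /before ->.
Qed.

End StoppingTime.

Section PathCouplingProcess.
Context {R : realType} {disp : measure_display} {W : measurableType disp}.
Context {T : countType} (Q : T * T -> T * T -> R) (X Y : nat -> W -> T).
Context (Pr : T * T -> probability W R).
Context (S : rel T) (d : T -> T -> nat) (D : nat).
Context (hQ : is_transition_matrix Q).
Context (hXY : is_markov_process Q (fun t w => (X t w, Y t w)) Pr).
Context (dD : forall x y, (d x y <= D)%N).

Let dist := dist_at d X Y.

Lemma measurable_dist_at t n : measurable [set w | dist t w = n].
Proof.
exact: (measurable_fibers [set z | pair_dist d z = n] (mp_measurable hXY t)).
Qed.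

Let measurable_const t n :
  measurable [set w | forall i, (i <= t)%N -> dist i w = n].
Proof.
rewrite (_ : mkset _ =
    \bigcap_(i in [set i | (i <= t)%N]) [set w | dist i w = n]) //.
by apply: bigcap_measurableType => i _; exact: measurable_dist_at.
Qed.

Lemma measurable_const_dist t :
  measurable [set w | forall i, (i <= t)%N -> dist i w = dist 0%N w].
Proof.
rewrite (_ : mkset _ =
    \bigcup_n [set w | forall i, (i <= t)%N -> dist i w = n]).
  by apply: bigcup_measurable => n _.
apply/seteqP; split=> [w cw|w [n _ cw] i it]; first by exists (dist 0%N w).
by rewrite !cw.
Qed.

Lemma stopped_byE k :
  [set w | exists2 t, stop_time d X Y 0 w = Some t & (t <= k)%N] =
  ~` [set w | forall i, (i <= k)%N -> dist i w = dist 0%N w].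
Proof.
apply/seteqP; split=> w /=.
  case: stop_timeP => [t _ change [_ [<-] tk] /(_ _ tk) const_k|_ [//]].
  by case/eqP: change; exact: const_k.
case: stop_timeP => [t before change|never] notconst.
  exists t.+1 => //; rewrite ltnNge; apply/negP => kt; apply: notconst => i ik.
  by apply: before; apply: leq_trans kt.
by case: notconst => i _; exact: never.
Qed.

Lemma measurable_dist_at_stop n :
  measurable [set w | dist_at_stop d X Y 0 w = n].
Proof.
pose never := \bigcap_(i in [set: nat]) [set w | dist i w = n].
pose exit t u := [set w | dist t.+1 w = n] `&`
  [set w | forall i, (i <= t)%N -> dist i w = u].
rewrite (_ : mkset _ =
    never `|` \bigcup_t \bigcup_(u in [set u | u != n]) exit t u).
  apply: measurableU.
    by apply: bigcap_measurableType => i _; exact: measurable_dist_at.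
  apply: bigcup_measurable => t _; apply: bigcup_measurable => u _.
  by apply: measurableI => //; exact: measurable_dist_at.
apply/seteqP; split=> w /=; rewrite /dist_at_stop.
  case: stop_timeP => [t before change dt|const d0].
    right; exists t => //; exists (dist 0%N w); last by split.
    by rewrite /= -dt eq_sym.
  by left=> i _; rewrite /= -d0; exact: const.
case=> [const|[t _ [u /= un [dt before]]]].
  have const0 i : dist i w = dist 0%N w by rewrite (const i)// (const 0%N).
  case: stop_timeP => [t _|_]; last exact: const.
  by rewrite [dist_at _ _ _ _ _]const0 eqxx.
rewrite (@stop_time_eq _ _ _ _ _ _ t)//.
  by move=> i it; rewrite [LHS]before// [RHS]before.
by rewrite [X in X != _]dt [X in _ != X]before// eq_sym.
Qed.

Let stop_ratio (w : W) : R :=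
  (dist_at_stop d X Y 0 w)%:R / (dist_at d X Y 0 w)%:R.

Lemma measurable_stop_ratio :
  measurable_fun [set: W] (fun w => (stop_ratio w)%:E).
Proof.
move=> _ A mA; rewrite setTI.
pose pairs w := (dist_at_stop d X Y 0 w, dist_at d X Y 0 w).
apply: (@measurable_fibers _ _ _ pairs
  [set ab | A (ab.1%:R / ab.2%:R : R)%:E]) => -[a b].
rewrite (_ : mkset _ = [set w | dist_at_stop d X Y 0 w = a] `&`
                       [set w | dist 0%N w = b]).
  apply: measurableI; first exact: measurable_dist_at_stop.
  exact: measurable_dist_at.
by apply/seteqP; split=> w /= => [[<- <-]|[<- <-]].
Qed.

Lemma exit_ratio_le_expectation n z :
  ((exit_ratio Q d n z)%:E <= 'E_(Pr z)[stop_ratio])%E.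
Proof.
rewrite unlock; apply: (until_change_le_integral hQ hXY (B := D%:R)).
- by rewrite lexx ler0n.
- by move=> *; exact: dist_ratio_le.
- exact: measurable_stop_ratio.
- by move=> w; rewrite lee_fin divr_ge0.
- by move=> w _; rewrite lee_fin divr_ge0.
move=> w t _ before change; rewrite lee_fin /stop_ratio /dist_at_stop.
have dt : dist_at d X Y t w = dist_at d X Y 0 w := before t (leqnn t).
by rewrite (stop_time_eq before change) -dt.
Qed.

Lemma survival_le_measure k z :
  ((survival Q d k z)%:E <=
   1 - Pr z [set w | exists2 t, stop_time d X Y 0 w = Some t & (t <= k)%N])%E.
Proof.
rewrite stopped_byE; set C := mkset _.
have mC : measurable C by exact: measurable_const_dist.
rewrite -probability_setC ?setCK; last exact: measurableC.
rewrite -[X in Pr z X]setIT -integral_indic//.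
apply: (until_change_le_integral hQ hXY (B := 1)).
- by rewrite ler01 lexx.
- by move=> *; rewrite lexx ler01.
- by apply: measurableT_comp => //; exact: measurable_indic.
- by move=> w; rewrite lee_fin.
- by move=> w const; rewrite indicE mem_set.
- by move=> w *; rewrite lee_fin.
Qed.

(** The one-step event [Z_0 = z, Z_1 = z'] has positive probability, so it meets
    every almost sure event; the stopping time exceeds 1 on it. *)
Lemma support_stays (hstay : stays_until_stop S d X Y Pr) z z' :
    S z.1 z.2 -> 0 < Q z z' -> pair_dist d z' = pair_dist d z ->
  S z'.1 z'.2.
Proof.
move=> Sz Qz' dz'; apply: contrapT => notS.
pose h i := if i is 0%N then z else z'.
pose C n := [set w | forall i, (i <= n)%N -> (X i w, Y i w) = h i].
have C0 : C 0%N = [set w | (X 0%N w, Y 0%N w) = z].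
  apply/seteqP; split=> w /=; first exact.
  by move=> Zw i; rewrite leqn0 => /eqP ->.
have C1 : Pr z (C 1%N) = (Q z z')%:E.
  have := mp_step hXY z 0 h.
  by rewrite -/(C 1%N) -/(C 0%N) C0 (mp_start hXY) mul1e.
have mC1 : measurable (C 1%N) by exact: measurable_cylinder hXY 1%N h.
have [N [mN PrN subN]] := hstay z.
have : (Pr z (C 1%N) <= Pr z N)%E.
  apply: le_measure; rewrite ?inE// => w Cw; apply: subN => /= stays.
  apply: notS; have [Z0 Z1] := (Cw 0%N isT, Cw 1%N isT).
  have dw1 : dist_at d X Y 1 w = dist_at d X Y 0 w.
    move: dz'; rewrite /pair_dist /dist_at.
    by rewrite -[z]/(h 0%N) -[z']/(h 1%N) -Z0 -Z1.
  have := stays 0%N 1%N.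
  rewrite -[X 1%N w]/((X 1%N w, Y 1%N w).1).
  rewrite -[Y 1%N w]/((X 1%N w, Y 1%N w).2) Z1.
  rewrite -[X 0%N w]/((X 0%N w, Y 0%N w).1).
  rewrite -[Y 0%N w]/((X 0%N w, Y 0%N w).2) Z0.
  apply=> //; rewrite /before_stop.
  by case: stop_timeP => // -[|//] _; rewrite dw1 eqxx.
by rewrite PrN C1 lee_fin leNgt Qz'.
Qed.

End PathCouplingProcess.

(** * The mixing time *)

Lemma mixing_time_le (R : realType) (T : countType) (P : T -> T -> R)
    (pi : T -> R) (eps b : R) (t : nat) :
    mixed_from P pi eps t -> t%:R <= b ->
  exists2 tau, is_mixing_time P pi eps tau & tau%:R <= b.
Proof.
move=> mixed tb.
have ex : exists t, `[< mixed_from P pi eps t >] by exists t; apply/asboolP.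
case: (ex_minnP ex) => tau /asboolP mixed_tau min_tau.
exists tau; first by split=> // s mixed_s; apply: min_tau; apply/asboolP.
by apply: le_trans tb; rewrite ler_nat; apply: min_tau; apply/asboolP.
Qed.

(** With [t.+1 <= (t %/ k).+1 * k], the decay in [t %/ k] is that of
    [t / k - 1], and [theta <= expR (- p * (1 - alpha))]. The lost block costs at
    most [expR (p * (1 - alpha)) <= expR 1], which is the factor [e] in the
    logarithm. *)
Lemma exp_decay_le (R : realType) (k t D : nat) (p alpha eps : R) :
    (0 < k)%N -> 0 < p -> p <= 1 -> 0 < alpha -> alpha < 1 ->
    0 < eps -> (0 < D)%N ->
    k%:R / (p * (1 - alpha)) * ln (expR 1 * D%:R / (eps * (1 - alpha)))
      < t.+1%:R ->
  (1 - p * (1 - alpha)) ^+ (t %/ k) / (1 - alpha) * D%:R <= eps.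
Proof.
move=> k0 p0 p1 a0 a1 eps0 D0 lt_t.
have g0 : 0 < 1 - alpha by rewrite subr_gt0.
set L := ln _ in lt_t; set r := p * (1 - alpha) in lt_t *.
have r0 : 0 < r by rewrite mulr_gt0.
have r1 : r <= 1.
  by rewrite -[leRHS]mulr1 ler_pM ?(ltW p0) ?(ltW g0)// gerBl ltW.
have lt_L : L < r * (t %/ k).+1%:R.
  have : k%:R / r * L < (t %/ k).+1%:R * k%:R.
    by apply: lt_le_trans lt_t _; rewrite -natrM ler_nat ltn_ceil.
  rewrite [X in _ < X]mulrC -mulrA ltr_pM2l ?ltr0n// mulrC ltr_pdivrMr//.
  by rewrite mulrC.
have pow_le : (1 - r) ^+ (t %/ k) <= expR (1 - L).
  apply: (@le_trans _ _ (expR (- r) ^+ (t %/ k))).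
    by apply: lerXn2r; rewrite ?nnegrE ?subr_ge0 ?expR_ge0// expR_ge1Dx.
  rewrite -expRM_natl ler_expR; move: lt_L; rewrite -natr1 mulrDr mulr1 => lt_L.
  rewrite -mulr_natl mulr1; lra.
have expL : expR (1 - L) = eps * (1 - alpha) / D%:R.
  rewrite expRD expRN lnK; last first.
    by rewrite posrE divr_gt0 ?mulr_gt0 ?expR_gt0 ?ltr0n.
  by field; rewrite ?expR_eq0 ?pnatr_eq0 ?gt_eqF// !andbT -?lt0n.
rewrite -mulrA; apply: le_trans (ler_wpM2r _ pow_le) _.
  by rewrite mulr_ge0// invr_ge0 ltW.
rewrite expL le_eqVlt; apply/orP; left; apply/eqP; field.
by rewrite pnatr_eq0 !gt_eqF.
Qed.

Theorem theorem2p2 (R : realType) (Omega : countType)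
    (P : Omega -> Omega -> R) (hP : is_transition_matrix P)
    (pi : Omega -> R) (hpi : is_equilibrium P pi)
    (d : Omega -> Omega -> nat) (hd : is_metric d)
    (D : nat) (hD : is_diameter d D)
    (S : rel Omega) (hS : path_metric S d)
    (Q : Omega * Omega -> Omega * Omega -> R) (hQ : is_path_coupling P S Q)
    (disp : measure_display) (W : measurableType disp)
    (X Y : nat -> W -> Omega) (Pr : Omega * Omega -> probability W R)
    (hXY : is_markov_process Q (fun t w => (X t w, Y t w)) Pr)
    (hstay : stays_until_stop S d X Y Pr)
    (k : nat) (p alpha : R)
    (hk : (0 < k)%N) (hp : 0 < p) (halpha0 : 0 < alpha) (halpha1 : alpha < 1)
    (hi : forall x y, S x y ->
       (p%:E <= Pr (x, y) [set w | exists2 t, stop_time d X Y 0 w = Some t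
                                            & (t <= k)%N])%E)
    (hii : forall x y, S x y ->
       ('E_(Pr (x, y))[fun w => ((dist_at_stop d X Y 0 w)%:R /
                                 (dist_at d X Y 0 w)%:R)%R] <= alpha%:E)%E)
    (eps : R) (heps0 : 0 < eps) (heps1 : eps < 1) :
  exists2 tau : nat, is_mixing_time P pi eps tau &
    tau%:R <= k%:R / (p * (1 - alpha)) *
              ln (expR 1 * D%:R / (eps * (1 - alpha))).
Proof.
have dD := hD.1.
have hQt := pc_transition hQ.
(* With [D = 0] there is a single state, and [ln 0 = 0] makes the bound 0. *)
case: (posnP D) => [D0|D_gt0].
  apply: (@mixing_time_le _ _ _ _ _ _ 0); last first.
    by rewrite D0 mulr0 mul0r ln0// mulr0.
  move=> x t _; apply: le_trans (ltW heps0).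
  apply: tv_dist_equilibrium_le => // f _ y.
  have -> : x = y; last by rewrite addr0.
  by apply/(metric_eq0 hd); apply/eqP; rewrite -leqn0 -D0.
(* An edge exists, so [p] is at most a probability. *)
have [a [b Sab]] : exists a b, S a b.
  have [x [y dxy]] := hD.2.
  have [[|z s] [/= + last_s] _] := pm_attained hS x y; last first.
    by case/andP=> Sxz _; exists x, z.
  by move: D_gt0; rewrite -dxy (metric_eq0 hd x y).2.
have p1 : p <= 1.
  rewrite -lee_fin; apply: le_trans (hi _ _ Sab) (probability_le1 _ _).
  rewrite stopped_byE; apply: measurableC.
  exact: measurable_const_dist hXY _.
have ratio_le n z : S z.1 z.2 -> exit_ratio Q d n z <= alpha.
  case: z => x y Sxy; rewrite -lee_fin.
  exact: le_trans (exit_ratio_le_expectation hQt hXY dD n (x, y)) (hii _ _ Sxy).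
have surv_le z : S z.1 z.2 -> survival Q d k z <= 1 - p.
  case: z => x y Sxy; rewrite -lee_fin.
  apply: le_trans (survival_le_measure d hQt hXY k (x, y)) _.
  by rewrite EFinB leeB// hi.
have stay := support_stays hXY hstay.
have a1 : 0 < 1 - alpha by rewrite subr_gt0.
set b0 := _ * ln _.
have b0_ge0 : 0 <= b0.
  apply: mulr_ge0; first by rewrite divr_ge0 ?mulr_ge0 ?(ltW hp) ?(ltW a1).
  apply: ln_ge0; rewrite ler_pdivlMr ?mulr_gt0// mul1r.
  apply: (@le_trans _ _ 1).
    apply: mulr_ile1; rewrite ?(ltW heps0) ?(ltW heps1) ?(ltW a1)//.
    by rewrite gerBl ltW.
  by rewrite mulr_ege1 ?ler1n// -expR0 ler_expR.
have /andP[floor_le lt_floor] := truncn_itv b0_ge0.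
apply: (mixing_time_le _ floor_le) => x t le_t.
apply: le_trans (exp_decay_le hk hp p1 halpha0 halpha1 heps0 D_gt0 (t := t) _);
  last by apply: lt_le_trans lt_floor _; rewrite ler_nat ltnS.
have theta0 : 0 <= 1 - p * (1 - alpha).
  by rewrite subr_ge0; apply: mulr_ile1; rewrite ?(ltW hp) ?(ltW a1)// gerBl ltW.
apply: tv_dist_equilibrium_le => // [|f f01 y].
  by rewrite !mulr_ge0 ?exprn_ge0// invr_ge0 ltW.
apply: le_trans (iterate_lipschitz hP hQ hd hS dD (ltW hp) p1 (ltW halpha0)
  halpha1 stay ratio_le surv_le t x y f01) _.
rewrite lerD2l ler_wpM2l ?ler_nat//.
by rewrite mulr_ge0 ?exprn_ge0// invr_ge0 ltW.
Qed.
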